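(* Let $P$ be a partially ordered set, $R$ a commutative unital ring, and $FI(P,R)$ the finitary incidence algebra of $P$ over $R$. Let $d=\{d_n\}_{n=0}^\infty$ be an $R$-linear higher derivation of $FI(P,R)$ (i.e. a higher derivation all of whose terms $d_n$ are $R$-linear). Then there exist a sequence $\rho=\{\rho_n\}_{n=1}^\infty\subseteq FI(P,R)$ and a higher transitive map $\sigma=\{\sigma_n\}_{n=0}^\infty$ such that $d=\Delta_\rho*\tilde\sigma$.
   Context: Here $\mathbb N=\{1,2,\dots\}$. Finitary incidence algebra: $FI(P,R)$ is the set of formal sums $\alpha=\sum_{x\le y}\alpha_{xy}e_{xy}$ ($x,y\in P$, $\alpha_{xy}\in R$, $e_{xy}$ a symbol) such that for any pair $x<y$ in $P$ there are only finitely many pairs $(u,v)$ with $x\le u<v\le y$ and $\alpha_{uv}\ne 0$. It is an $R$-algebra with the natural $R$-module structure and the convolution product $\alpha\beta=\sum_{x\le y}\left(\sum_{x\le z\le y}\alpha_{xz}\beta_{zy}\right)e_{xy}$; its identity is $\sum_{x\in P}1_Re_{xx}$. Higher derivations: for a ring $A$, a higher derivation of $A$ is a sequence $d=\{d_n\}_{n=0}^\infty$ of additive maps $A\to A$ with $d_0=\mathrm{id}_A$ and $d_n(rs)=\sum_{i+j=n}d_i(r)d_j(s)$ for all $n\in\mathbb N$, $r,s\in A$ (where $i,j\ge 0$). The product of higher derivations is $(d'*d'')_n=\sum_{i+j=n}d'_i\circ d''_j$. Inner higher derivations: for $r\in A$ and $k\in\mathbb N$ define the higher derivation $[r,k]=\{[r,k]_n\}_{n=0}^\infty$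 by $[r,k]_0=\mathrm{id}_A$ and, for $n\in\mathbb N$, $x\in A$: $[r,k]_n(x)=0$ if $k\nmid n$, and $[r,k]_n(x)=r^lx-r^{l-1}xr$ if $n=kl$ (with $r^0xr=xr$). For a sequence $r=\{r_n\}_{n=1}^\infty\subseteq A$, the inner higher derivation $\Delta_r$ is given by $(\Delta_r)_0=\mathrm{id}_A$ and $(\Delta_r)_n=([r_1,1]*\dots*[r_n,n])_n$ for $n\in\mathbb N$. Higher transitive maps: a higher transitive map is a sequence $\sigma=\{\sigma_n\}_{n=0}^\infty$ of maps $\sigma_n:\{(x,y)\in P\times P\mid x\le y\}\to R$ such that $\sigma_0(x,y)=1_R$ for all $x\le y$, and $\sigma_n(x,y)=\sum_{i+j=n}\sigma_i(x,z)\sigma_j(z,y)$ for all $n$ and all $x\le z\le y$. It induces the higher derivation $\tilde\sigma=\{\tilde\sigma_n\}_{n=0}^\infty$ of $FI(P,R)$ given by $\tilde\sigma_n(\alpha)=\sum_{x\le y}\sigma_n(x,y)\alpha_{xy}e_{xy}$. *)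

(* Defs.v *)
From HB Require Import structures.
From mathcomp Require Import all_boot all_order all_algebra.
From mathcomp Require Import boolp classical_sets functions cardinality fsbigop.

Set Implicit Arguments.
Unset Strict Implicit.
Unset Printing Implicit Defensive.

Import Order.TTheory GRing.Theory.

Local Open Scope classical_set_scope.
Local Open Scope ring_scope.

(** * The finitary incidence algebra *)

Section Carrier.
Context (disp : Order.disp_t) (P : porderType disp) (R : comPzRingType).

(* A formal sum over the pairs x <= y is a function P -> P -> R that vanishes
   at the pairs (x, y) with x </= y. *)
Definition finitary (a : P -> P -> R) : Prop :=
  (forall x y : P, ~~ (x <= y)%O -> a x y = 0) /\
  (forall x y : P, (x < y)%O ->
     finite_set [set uv : P * P |
       [/\ (x <= uv.1)%O, (uv.1 < uv.2)%O, (uv.2 <= y)%O & a uv.1 uv.2 != 0]]).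

Record FI : Type := MkFI {
  fi_fun :> P -> P -> R;
  fi_finitary : finitary fi_fun
}.

HB.instance Definition _ := gen_eqMixin FI.
HB.instance Definition _ := gen_choiceMixin FI.

Lemma fiP (a b : FI) : (forall x y, (x <= y)%O -> a x y = b x y) -> a = b.
Proof.
case: a b => [a fa] [b fb] /= ab.
have E : a = b.
  apply/funext => x; apply/funext => y; have [xy|xy] := boolP (x <= y)%O.
    exact: ab.
  by rewrite fa.1 // fb.1.
by case: _ / E fb => fb; rewrite (Prop_irrelevance fa fb).
Qed.

Lemma finitary_sub (a b : P -> P -> R) :
  finitary a -> (forall x y, a x y = 0 -> b x y = 0) -> finitary b.
Proof.
move=> [a0 af] ab; split=> [x y xy|x y xy]; first by rewrite ab ?a0.
apply: sub_finite_set (af _ _ xy) => -[u v] /= [? ? ? buv]; split=> //.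
by apply: contra_neq buv; apply: ab.
Qed.

Lemma finitary_zero : finitary (fun _ _ => 0).
Proof.
split=> // x y _; rewrite (_ : [set _ | _] = set0) //.
by apply/seteqP; split=> // -[u v] /= [_ _ _]; rewrite eqxx.
Qed.

Lemma finitary_opp (a : FI) : finitary (fun x y => - a x y).
Proof. by apply: finitary_sub (fi_finitary a) _ => x y ->; rewrite oppr0. Qed.

Lemma finitary_scale (k : R) (a : FI) : finitary (fun x y => k * a x y).
Proof. by apply: finitary_sub (fi_finitary a) _ => x y ->; rewrite mulr0. Qed.

Lemma finitary_hadamard (s : P -> P -> R) (a : FI) :
  finitary (fun x y => s x y * a x y).
Proof. by apply: finitary_sub (fi_finitary a) _ => x y ->; rewrite mulr0. Qed.

Lemma finitary_add (a b : FI) : finitary (fun x y => a x y + b x y).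
Proof.
case: (fi_finitary a) (fi_finitary b) => [a0 af] [b0 bf].
split=> [x y xy|x y xy]; first by rewrite a0 // b0 // addr0.
have /(conj (af _ _ xy)) := bf _ _ xy.
rewrite -finite_setU; apply: sub_finite_set.
move=> [u v] /= [xu uv vy abuv].
have [a_uv|a_uv] := eqVneq (a u v) 0; last by left.
by right; split=> //; move: abuv; rewrite a_uv add0r.
Qed.

Lemma finitary_one : finitary (fun x y => (x == y)%:R).
Proof.
split=> [x y|x y _].
  by have [->|//] := eqVneq x y; rewrite lexx.
rewrite (_ : [set _ | _] = set0) //.
by apply/seteqP; split=> // -[u v] /= [_ /lt_eqF -> _]; rewrite eqxx.
Qed.

(* By finitarity of [a] and [b], the sum below has finite support. *)
Definition convolution (a b : P -> P -> R) (x y : P) : R :=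
  \sum_(z \in [set z : P | (x <= z <= y)%O]) a x z * b z y.

Lemma convolution_neq0 (a b : FI) x y : convolution a b x y != 0 ->
  exists z, [/\ (x <= z)%O, (z <= y)%O, a x z != 0 & b z y != 0].
Proof.
move=> /(@fsbigN1 _ _ _ unit _ _ (fun _ z => a x z * b z y) tt).
case=> z /= /andP[xz zy] abz; exists z; split=> //.
  by apply: contra_neq abz => ->; rewrite mul0r.
by apply: contra_neq abz => ->; rewrite mulr0.
Qed.

Lemma finitary_convolution (a b : FI) : finitary (convolution a b).
Proof.
split=> [x y|x y xy].
  apply: contraNeq => /convolution_neq0 [z [xz zy _ _]]; exact: le_trans xz zy.
pose S (c : FI) := [set uv : P * P |
  [/\ (x <= uv.1)%O, (uv.1 < uv.2)%O, (uv.2 <= y)%O & c uv.1 uv.2 != 0]].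
have Sf c : finite_set (S c) by exact: (fi_finitary c).2.
apply: (@sub_finite_set _ _ (S a `|` S b `|`
    [set (p.1.1, p.2.2) | p in S a `*` S b])); last first.
  rewrite !finite_setU; split; first by split.
  by apply: finite_image; exact: finite_setX.
move=> [u v] /= [xu uv vy /convolution_neq0 [z [uz zv auz bzv]]].
have [zu|zu] := eqVneq z u; first by left; right; rewrite zu in bzv.
have [zv'|zv'] := eqVneq z v; first by left; left; rewrite zv' in auz.
right; exists ((u, z), (z, v)) => //; split; split=> //=.
- by rewrite lt_neqAle eq_sym zu.
- exact: le_trans zv vy.
- exact: le_trans xu uz.
- by rewrite lt_neqAle zv'.
Qed.

(* Finitely many elements suffice to compute convolutions within [x, y]. *)
Lemma convolution_local (s : seq FI) (x y : P) : exists2 Z : seq P,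
  x \in Z & forall a b u v, a \in s -> u \in Z -> (x <= u)%O -> (v <= y)%O ->
    convolution a b u v = \sum_(z <- Z | (u <= z <= v)%O) a u z * b z v.
Proof.
have [Z Zf [Zx ZP]] : exists2 Z : set P, finite_set Z & Z x /\
    forall a u v, a \in s -> (x <= u)%O -> (u < v)%O -> (v <= y)%O ->
      a u v != 0 -> Z v.
  elim: s => [|a s [Z Zf [Zx ZP]]]; first by exists [set x].
  have [xy|xy] := boolP (x < y)%O; last first.
    exists Z => //; split=> // c u v _ xu uv vy _; case/negP: xy.
    exact: le_lt_trans xu (lt_le_trans uv vy).
  exists (Z `|` [set uv.2 | uv in [set uv : P * P |
    [/\ (x <= uv.1)%O, (uv.1 < uv.2)%O, (uv.2 <= y)%O & a uv.1 uv.2 != 0]]]).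
    by rewrite finite_setU; split=> //; apply/finite_image/(fi_finitary a).2.
  split; first by left.
  move=> c u v; rewrite inE => /orP[/eqP->|cs] xu uv vy cuv; first by right; exists (u, v).
  by left; apply: (ZP c u v).
have /finite_seqP [Z' ZE] := Zf.
exists (undup Z') => [|a b u v sa uZ xu vy].
  by move: Zx; rewrite ZE mem_undup.
rewrite /convolution; apply/esym/bigfs; first exact: undup_uniq.
move=> z /andP[uz zv] zZ.
have [->|auz] := eqVneq (a u z) 0; first by rewrite mul0r.
case/negP: zZ; have [->//|zu] := eqVneq z u.
have uz' : (u < z)%O by rewrite lt_neqAle eq_sym zu.
have : Z z by exact: ZP sa xu uz' (le_trans zv vy) auz.
by rewrite ZE mem_undup.
Qed.

Definition fi_zero := MkFI finitary_zero.
Definition fi_opp (a : FI) := MkFI (finitary_opp a).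
Definition fi_add (a b : FI) := MkFI (finitary_add a b).
Definition fi_one := MkFI finitary_one.
Definition fi_mul (a b : FI) := MkFI (finitary_convolution a b).
Definition fi_scale (k : R) (a : FI) := MkFI (finitary_scale k a).

Lemma fi_addA : associative fi_add.
Proof. by move=> a b c; apply: fiP => x y _ /=; rewrite addrA. Qed.

Lemma fi_addC : commutative fi_add.
Proof. by move=> a b; apply: fiP => x y _ /=; rewrite addrC. Qed.

Lemma fi_add0 : left_id fi_zero fi_add.
Proof. by move=> a; apply: fiP => x y _ /=; rewrite add0r. Qed.

Lemma fi_addN : left_inverse fi_zero fi_opp fi_add.
Proof. by move=> a; apply: fiP => x y _ /=; rewrite addNr. Qed.

HB.instance Definition _ :=
  GRing.isZmodule.Build FI fi_addA fi_addC fi_add0 fi_addN.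

Lemma fi_mulA : associative fi_mul.
Proof.
move=> a b c; apply: fiP => x y xy /=.
have [Z xZ ZP] := convolution_local [:: a; b; fi_mul a b] x y.
rewrite (ZP a (fi_mul b c)) /=; [|by rewrite !inE ?eqxx ?orbT|by []..].
rewrite (ZP (fi_mul a b) c) /=; [|by rewrite !inE ?eqxx ?orbT|by []..].
rewrite big_seq_cond.
under eq_bigr => z /andP[zZ /andP[xz zy]].
  rewrite (ZP b c z y) //; last by rewrite !inE ?eqxx ?orbT.
  rewrite big_distrr /=; over.
rewrite -big_seq_cond.
under [RHS]eq_bigr => w /andP[xw wy].
  rewrite (ZP a b x w) //; last by rewrite !inE ?eqxx ?orbT.
  rewrite big_distrl /=; over.
rewrite (exchange_big_dep (fun w => (x <= w <= y)%O)) /=; last first.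
  by move=> z w /andP[xz _] /andP[zw ->]; rewrite (le_trans xz zw).
apply: eq_bigr => w /andP[xw wy]; apply: eq_big => [z|z _]; last by rewrite mulrA.
apply/andP/idP => [[/andP[-> _] /andP[-> _]] //|/andP[xz zw]].
by rewrite xz zw wy (le_trans zw wy).
Qed.

Lemma fi_mul1 : left_id fi_one fi_mul.
Proof.
move=> a; apply: fiP => x y xy /=; rewrite /convolution.
rewrite -(@bigfs _ _ _ _ [:: x] (fun z => (x <= z <= y)%O)) //=.
  by rewrite big_mkcond big_seq1 lexx xy eqxx mul1r.
by move=> z _; rewrite inE eq_sym => /negPf->; rewrite mul0r.
Qed.

Lemma fi_mulr1 : right_id fi_one fi_mul.
Proof.
move=> a; apply: fiP => x y xy /=; rewrite /convolution.
rewrite -(@bigfs _ _ _ _ [:: y] (fun z => (x <= z <= y)%O)) //=.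
  by rewrite big_mkcond big_seq1 lexx xy eqxx mulr1.
by move=> z _; rewrite inE => /negPf->; rewrite mulr0.
Qed.

Lemma fi_mulDl : left_distributive fi_mul fi_add.
Proof.
move=> a b c; apply: fiP => x y xy /=.
have [Z xZ ZP] := convolution_local [:: a; b; fi_add a b] x y.
rewrite (ZP (fi_add a b) c) /=; [|by rewrite !inE ?eqxx ?orbT|by []..].
rewrite (ZP a c) /=; [|by rewrite !inE ?eqxx ?orbT|by []..].
rewrite (ZP b c) /=; [|by rewrite !inE ?eqxx ?orbT|by []..].
by rewrite -big_split; apply: eq_bigr => z _; rewrite /= mulrDl.
Qed.

Lemma fi_mulDr : right_distributive fi_mul fi_add.
Proof.
move=> a b c; apply: fiP => x y xy /=.
have [Z xZ ZP] := convolution_local [:: a] x y.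
rewrite (ZP a (fi_add b c)) /=; [|by rewrite !inE ?eqxx ?orbT|by []..].
rewrite (ZP a b) /=; [|by rewrite !inE ?eqxx ?orbT|by []..].
rewrite (ZP a c) /=; [|by rewrite !inE ?eqxx ?orbT|by []..].
by rewrite -big_split; apply: eq_bigr => z _; rewrite /= mulrDr.
Qed.

HB.instance Definition _ := GRing.Zmodule_isPzRing.Build FI
  fi_mulA fi_mul1 fi_mulr1 fi_mulDl fi_mulDr.

Lemma fi_scaleA k l (a : FI) : fi_scale k (fi_scale l a) = fi_scale (k * l) a.
Proof. by apply: fiP => x y _ /=; rewrite mulrA. Qed.

Lemma fi_scale1 : left_id 1 fi_scale.
Proof. by move=> a; apply: fiP => x y _ /=; rewrite mul1r. Qed.

Lemma fi_scaleDr : right_distributive fi_scale +%R.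
Proof. by move=> k a b; apply: fiP => x y _ /=; rewrite mulrDr. Qed.

Lemma fi_scaleDl a : {morph fi_scale^~ a : k l / k + l}.
Proof. by move=> k l; apply: fiP => x y _ /=; rewrite mulrDl. Qed.

HB.instance Definition _ := GRing.Zmodule_isLmodule.Build R FI
  fi_scaleA fi_scale1 fi_scaleDr fi_scaleDl.

(* MathComp's [algType] requires 1 != 0, which fails if [P] is empty or [R] is
   trivial, so the compatibility of the two structures is left as lemmas. *)
Lemma fi_scalerAl (k : R) (a b : FI) : k *: (a * b) = (k *: a) * b.
Proof.
apply: fiP => x y xy.
have [Z xZ ZP] := convolution_local [:: a; k *: a] x y.
change (k * convolution a b x y = convolution (k *: a) b x y).
rewrite (ZP a b) /=; [|by rewrite !inE ?eqxx ?orbT|by []..].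
rewrite (ZP (k *: a) b) /=; [|by rewrite !inE ?eqxx ?orbT|by []..].
by rewrite big_distrr; apply: eq_bigr => z _; rewrite /= mulrA.
Qed.

Lemma fi_scalerAr (k : R) (a b : FI) : k *: (a * b) = a * (k *: b).
Proof.
apply: fiP => x y xy.
have [Z xZ ZP] := convolution_local [:: a] x y.
change (k * convolution a b x y = convolution a (k *: b) x y).
rewrite (ZP a b) /=; [|by rewrite !inE ?eqxx ?orbT|by []..].
rewrite (ZP a (k *: b)) /=; [|by rewrite !inE ?eqxx ?orbT|by []..].
by rewrite big_distrr; apply: eq_bigr => z _; rewrite /= mulrCA.
Qed.

(* Only the values of [s] at the pairs x <= y matter. *)
Definition hadamard (s : P -> P -> R) (a : FI) : FI :=
  MkFI (finitary_hadamard s a).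

End Carrier.

Arguments FI {disp} P R.

(** * Higher derivations *)

Section HigherDerivations.
Context (A : pzRingType).
Implicit Types d : nat -> A -> A.

Definition higher_derivation d : Prop :=
  [/\ d 0 = id,
      forall n, zmod_morphism (d n) &
      forall n, (0 < n)%N -> forall r s,
        d n (r * s) = \sum_(i < n.+1) d i r * d (n - i)%N s].

Definition hd_mul d d' : nat -> A -> A :=
  fun n x => \sum_(i < n.+1) d i (d' (n - i)%N x).

Definition hd_one : nat -> A -> A := fun n x => if n == 0%N then x else 0.

Definition hd_elem (r : A) (k : nat) : nat -> A -> A :=
  fun n x =>
    if n == 0%N then x
    else if (k %| n)%N then
      let l := (n %/ k)%N in r ^+ l * x - r ^+ l.-1 * x * r
    else 0.

(* The sequence [r] is indexed from 1; [r 0] is not used.  The big operator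
   associates to the right, which is harmless: [hd_mul] is associative on
   sequences of additive maps, and [hd_one] is neutral for it. *)
Definition inner_hd (r : nat -> A) : nat -> A -> A :=
  fun n =>
    if n == 0%N then id
    else (\big[hd_mul/hd_one]_(1 <= k < n.+1) hd_elem (r k) k) n.

End HigherDerivations.

(** * Higher transitive maps *)

Section HigherTransitiveMaps.
Context (disp : Order.disp_t) (P : porderType disp) (R : comPzRingType).

(* The values of [sigma n] at the pairs (x, y) with x </= y are unconstrained
   and do not affect [transitive_hd sigma]. *)
Definition higher_transitive (sigma : nat -> P -> P -> R) : Prop :=
  (forall x y, (x <= y)%O -> sigma 0 x y = 1) /\
  (forall n x z y, (x <= z)%O -> (z <= y)%O ->
     sigma n x y = \sum_(i < n.+1) sigma i x z * sigma (n - i)%N z y).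

Definition transitive_hd (sigma : nat -> P -> P -> R) :
    nat -> FI P R -> FI P R :=
  fun n => hadamard (sigma n).

End HigherTransitiveMaps.

(* Main.v *)
(** A higher derivation [d] of [A] is a ring morphism a |-> sum_n d_n(a) t^n
    from [A] to the power series ring A[[t]] that lifts the identity.  In this
    language [r, k] is conjugation x |-> (1 - r t^k)^-1 x (1 - r t^k), so that
    [d] can be divided on the left by [r, k] without changing its terms of
    degree < k, and its k-th term d_k(a) becomes d_k(a) + a r - r a.

    The elements rho_1, rho_2, ... are chosen one after the other so that, in
    the limit, all the idempotents e_x are sent to constant series.  If this
    already holds in degrees < n, then d_n is a derivation on the diagonal
    elements, and rho_n(u, x) = d_n(e_x)(u, x) does the job.  That rho_n is
    finitary is seen by applying d_n to the idempotents e_S, the sum of the e_x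
    for x in S: the support of d_n(e_S) contains all the edges (u, x) of the
    support of rho_n with x in S and u not in S, and a directed graph without
    loops all of whose cuts are finite is itself finite.  Once all e_x are
    constants, e_x d_n(a) e_y = d_n(e_x a e_y) is the multiple a_xy d_n(e_xy),
    i.e. [d] is induced by sigma_n(x, y) = d_n(e_xy)(x, y). *)

Require Import Defs.
From HB Require Import structures.
From mathcomp Require Import all_boot all_order all_algebra.
From mathcomp Require Import boolp classical_sets functions cardinality fsbigop.
Import Order.TTheory GRing.Theory.
Local Open Scope ring_scope.

Set Implicit Arguments.
Unset Strict Implicit.
Unset Printing Implicit Defensive.

(* A maximal set M of edges in which no head is a tail is contained in a single
   cut, and every other edge starts where an edge of M ends or ends where one starts. *)
Lemma finite_set_of_cuts (T : Type) (B : set (T * T)) :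
  (forall p, B p -> p.1 <> p.2) ->
  (forall S : set T, finite_set [set p | [/\ B p, S p.2 & ~ S p.1]]%classic) ->
  finite_set B.
Proof.
move=> Birr cutB.
pose unlinked (M : set (T * T)) :=
  (M `<=` B)%classic /\ forall p q, M p -> M q -> p.1 <> q.2.
have [F Funl Ftot|M [[MB Munl] Mmax]] := @Zorn_bigcup _ unlinked.
  split=> [p [X FX Xp]|p q [X FX Xp] [Y FY Yq]]; first exact: (Funl X FX).1.
  have [XY|YX] := Ftot X Y FX FY.
    by apply: (Funl Y FY).2 => //; apply: XY.
  by apply: (Funl X FX).2 => //; apply: YX.
have Mfin : finite_set M.
  apply: sub_finite_set (cutB [set q.2 | q in M]%classic) => p Mp.
  split; [exact: MB|by exists p|].
  by move=> [q Mq qp]; apply: (Munl p q).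
apply: (@sub_finite_set _ _ (M `|`
   (\bigcup_(q in M) [set p | B p /\ p.1 = q.2] `|`
    \bigcup_(q in M) [set p | B p /\ p.2 = q.1]))%classic); last first.
  (* As there are no loops, the edges leaving one vertex lie in a cut, and so do those entering
     it. *)
  rewrite !finite_setU; split=> //; split; apply: bigcup_finite => // q _.
    apply: sub_finite_set (cutB [set z | z <> q.2]%classic) => p /= [Bp pq].
    by split=> // p2; apply: (Birr p Bp); rewrite pq.
  apply: sub_finite_set (cutB [set q.1]%classic) => p /= [Bp pq].
  by split=> // p1; apply: (Birr p Bp); rewrite pq.
move=> p Bp; apply: contrapT => npU.
have npM : ~ M p by move=> Mp; apply: npU; left.
(* Since [p] is linked to no edge of [M], adding it contradicts maximality. *)
apply: (Mmax (M `|` [set p])%classic).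
  by split=> [q|/(_ p) subM]; [left|apply/npM/subM; right].
split=> [q [/MB //|-> //]|q q' [Mq|->] [Mq'|->]].
- exact: Munl.
- by move=> qp; apply: npU; right; right; exists q.
- by move=> pq; apply: npU; right; left; exists q'.
- exact: Birr.
Qed.

(** Put m = i + j: both sides run over the triples of naturals with sum n. Associativity of series
    and of [hd_mul] reduces to this. *)
Lemma sum_antidiagonalA (V : nmodType) (T : nat -> nat -> nat -> V) (n : nat) :
  \sum_(i < n.+1) \sum_(j < (n - i).+1) T i j (n - i - j)%N =
  \sum_(m < n.+1) \sum_(i < m.+1) T i (m - i)%N (n - m)%N.
Proof.
transitivity (\sum_(i < n.+1) \sum_(m < n.+1 | (i <= m)%N) T i (m - i)%N (n - m)%N).
  apply: eq_bigr => -[i /= lt_in] _.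
  rewrite -(big_geq_mkord _ _ xpredT (fun m => T i (m - i)%N (n - m)%N)).
  rewrite -[X in index_iota X]add0n big_addn subSn // big_mkord.
  by apply: eq_bigr => j _; rewrite addnK addnC subnDA.
rewrite (exchange_big_dep predT) //=; apply: eq_bigr => -[m /= lt_mn] _.
by rewrite (big_ord_narrow_leq (lt_mn : (m <= n)%N)).
Qed.

(* The alias keeps the convolution product apart from the pointwise ring
   structure on functions. *)
Definition series (A : pzRingType) := nat -> A.

(** * Power series over a ring *)

Section Series.
Context (A : pzRingType).
Implicit Types f g h : series A.

HB.instance Definition _ := GRing.Zmodule.copy (series A) (nat -> A).

Lemma coef_seriesD f g n : (f + g) n = f n + g n.
Proof. by []. Qed.

Definition series_one : series A := fun n => (n == 0)%:R.
Definition series_mul f g : series A := fun n => \sum_(i < n.+1) f i * g (n - i)%N.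

Lemma series_mulA : associative series_mul.
Proof.
move=> f g h; apply/funext => n; rewrite /series_mul.
under eq_bigr do rewrite big_distrr.
under [RHS]eq_bigr do rewrite big_distrl.
rewrite /= (sum_antidiagonalA (fun i j k => f i * (g j * h k))).
by apply: eq_bigr => m _; apply: eq_bigr => i _; rewrite mulrA.
Qed.

Lemma series_mul1 : left_id series_one series_mul.
Proof.
move=> f; apply/funext => n; rewrite /series_mul big_ord_recl /= mul1r subn0.
by rewrite big1 ?addr0 // => i _; rewrite mul0r.
Qed.

Lemma series_mulr1 : right_id series_one series_mul.
Proof.
move=> f; apply/funext => n; rewrite /series_mul big_ord_recr /= subnn mulr1.
rewrite big1 ?add0r // => i _.
by rewrite /series_one subn_eq0 leqNgt ltn_ord mulr0.
Qed.

Lemma series_mulDl : left_distributive series_mul +%R.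
Proof.
move=> f g h; apply/funext => n; rewrite [RHS]coef_seriesD -big_split /=.
by apply: eq_bigr => i _; rewrite mulrDl.
Qed.

Lemma series_mulDr : right_distributive series_mul +%R.
Proof.
move=> f g h; apply/funext => n; rewrite [RHS]coef_seriesD -big_split /=.
by apply: eq_bigr => i _; rewrite mulrDr.
Qed.

HB.instance Definition _ := GRing.Zmodule_isPzRing.Build (series A)
  series_mulA series_mul1 series_mulr1 series_mulDl series_mulDr.

Lemma coef_seriesM f g n : (f * g) n = \sum_(i < n.+1) f i * g (n - i)%N.
Proof. by []. Qed.

(** Multiplication by t^k. *)
Definition shift k f : series A := fun n => if (k <= n)%N then f (n - k)%N else 0.

Lemma shiftM k f g : shift k f * g = shift k (f * g).
Proof.
apply/funext => n; rewrite /shift !coef_seriesM.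
case: leqP => [le_kn|lt_nk]; last first.
  by rewrite big1 // => i _; rewrite leqNgt (leq_trans _ lt_nk) ?mul0r.
under eq_bigr do rewrite (fun_if ( *%R^~ _)) mul0r.
rewrite -big_mkcond /=.
rewrite -(big_geq_mkord _ _ xpredT (fun i => f (i - k)%N * g (n - i)%N)).
rewrite -[X in index_iota X]add0n big_addn subSn // big_mkord.
by apply: eq_bigr => i _; rewrite addnK addnC subnDA.
Qed.

(* The series 1 - r t^k, for 0 < k. *)
Definition one_minus_monomial (r : A) k : series A :=
  fun n => (n == 0)%:R - (n == k)%:R * r.

(* The sum over l of r^l t^(k l), for 0 < k. *)
Definition geometric_series (r : A) k : series A :=
  fun n => if (k %| n)%N then r ^+ (n %/ k) else 0.

Lemma coef_one_minusM r k f n :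
  (one_minus_monomial r k * f) n = f n - (if (k <= n)%N then r * f (n - k)%N else 0).
Proof.
rewrite coef_seriesM /one_minus_monomial.
under eq_bigr do rewrite mulrBl.
rewrite sumrB; congr (_ - _).
  by rewrite big_ord_recl /= mul1r subn0 big1 ?addr0 // => i _; rewrite mul0r.
case: leqP => [le_kn|lt_nk].
  rewrite (bigD1 (Ordinal (le_kn : (k < n.+1)%N))) //= eqxx mul1r big1 ?addr0 //.
  by move=> i; rewrite -val_eqE /= => /negPf->; rewrite !mul0r.
by rewrite big1 // => i _; rewrite ltn_eqF ?mul0r // (leq_trans _ lt_nk).
Qed.

Lemma coef_Mone_minus r k f n :
  (f * one_minus_monomial r k) n = f n - (if (k <= n)%N then f (n - k)%N * r else 0).
Proof.
rewrite coef_seriesM /one_minus_monomial.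
under eq_bigr do rewrite mulrBr.
rewrite sumrB; congr (_ - _).
  rewrite big_ord_recr /= subnn mulr1 big1 ?add0r // => i _.
  by rewrite subn_eq0 leqNgt ltn_ord mulr0.
case: leqP => [le_kn|lt_nk].
  have lt_ : (n - k < n.+1)%N by rewrite ltnS leq_subr.
  rewrite (bigD1 (Ordinal lt_)) //= subKn // eqxx mul1r big1 ?addr0 //.
  move=> i; rewrite -val_eqE /= => /negPf ne.
  case: eqP => [eq_k|]; last by rewrite mul0r mulr0.
  by move: ne; rewrite -eq_k subKn ?eqxx // -ltnS.
rewrite big1 // => i _; rewrite ltn_eqF ?mul0r ?mulr0 //.
exact: leq_ltn_trans (leq_subr _ _) lt_nk.
Qed.

(** The coefficients of g = 1 + r t^k g. *)
Lemma geometric_rec r k n : (0 < k)%N ->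
  geometric_series r k n =
  (n == 0)%:R + (if (k <= n)%N then r * geometric_series r k (n - k)%N else 0).
Proof.
move=> k0; rewrite /geometric_series; case: leqP => [le_kn|lt_nk]; last first.
  rewrite addr0; case: n lt_nk => [|n] lt_nk; first by rewrite dvdn0 div0n.
  by rewrite gtnNdvd.
rewrite gtn_eqF ?(leq_trans k0) // add0r dvdn_subl //.
case: ifP => _; rewrite ?mulr0 // -exprS; congr (_ ^+ _).
by rewrite -{1}(subnK le_kn) divnDr // divnn k0 addn1.
Qed.

Lemma geometric_commr r k n : r * geometric_series r k n = geometric_series r k n * r.
Proof.
by rewrite /geometric_series; case: ifP => _; rewrite ?mulr0 ?mul0r // -exprS exprSr.
Qed.

Lemma geometricK r k : (0 < k)%N -> geometric_series r k * one_minus_monomial r k = 1.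
Proof.
move=> k0; apply/funext => n.
rewrite coef_Mone_minus -geometric_commr {1}geometric_rec //; exact: addrK.
Qed.

End Series.

(** * Division by elementary inner higher derivations *)

Section HigherDerivationProducts.
Context (A : pzRingType).
Implicit Types (d : nat -> A -> A) (r : A) (k n : nat).

Definition hd_series d (a : A) : series A := d^~ a.

Lemma hd_mul1 d : hd_mul (@hd_one A) d = d.
Proof.
apply/funext => n; apply/funext => a.
rewrite /hd_mul big_ord_recl /= subn0.
by rewrite big1 ?addr0 // => i _.
Qed.

Lemma hd_mulA d1 d2 d3 : (forall n, zmod_morphism (d1 n)) ->
  hd_mul (hd_mul d1 d2) d3 = hd_mul d1 (hd_mul d2 d3).
Proof.
move=> d1B; apply/funext => n; apply/funext => a; rewrite /hd_mul.
rewrite -(sum_antidiagonalA (fun i j l => d1 i (d2 j (d3 l a)))).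
apply: eq_bigr => i _.
pose d1i := GRing.isZmodMorphism.Build _ _ (d1 i) (d1B i).
pose f : {additive A -> A} := HB.pack (d1 i) d1i.
exact/esym/(raddf_sum f).
Qed.

Lemma higher_derivationM d : higher_derivation d ->
  forall a b, hd_series d (a * b) = hd_series d a * hd_series d b.
Proof.
move=> [d0 _ dM] a b; apply/funext => -[|n]; last exact: dM.
by rewrite coef_seriesM big_ord1 /hd_series d0.
Qed.

(** The right-hand side is the coefficient of t^n in g a (1 - r t^k), g being the geometric series;
    so [r, k] is a conjugation. *)
Lemma hd_elem_geometric r k n a : (0 < k)%N -> hd_elem r k n a =
  geometric_series r k n * a -
  (if (k <= n)%N then geometric_series r k (n - k)%N * a * r else 0).
Proof.
move=> k0; rewrite /hd_elem /geometric_series.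
case: n => [|n]; first by rewrite leqNgt k0 dvdn0 div0n mul1r subr0.
rewrite /=; case: leqP => [le_kn|lt_nk]; last first.
  by rewrite gtnNdvd // mul0r subr0.
rewrite dvdn_subl //; case: ifP => [kn|_]; last by rewrite !mul0r subr0.
suff -> : (n.+1 %/ k = ((n.+1 - k) %/ k).+1)%N by [].
by rewrite -{1}(subnK le_kn) divnDr // divnn k0 addn1.
Qed.

Lemma hd_elem_lt r k n : (n < k)%N -> hd_elem r k n = @hd_one A n.
Proof.
move=> lt_nk; apply/funext => a; rewrite /hd_elem /hd_one.
by case: n lt_nk => // n lt_nk; rewrite gtnNdvd.
Qed.

Lemma hd_elemB r k n : (0 < k)%N -> zmod_morphism (hd_elem r k n).
Proof.
move=> k0 a b; rewrite !hd_elem_geometric //.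
case: leqP => _; rewrite ?subr0 !mulrBr //.
by rewrite mulrBl !opprD addrACA.
Qed.

(** The left quotient of [d] by [r, k]: the inverse conjugation applied after [d]. *)
Definition hd_conj r k d : nat -> A -> A :=
  fun n a => (one_minus_monomial r k * hd_series d a * geometric_series r k) n.

Section Conj.
Context (r : A) (k : nat) (k_gt0 : (0 < k)%N) (d : nat -> A -> A).

Lemma hd_conj_series a : hd_series (hd_conj r k d) a * one_minus_monomial r k =
  one_minus_monomial r k * hd_series d a.
Proof. by rewrite -[RHS]mulr1 -(geometricK r k_gt0) [RHS]mulrA. Qed.

(** Degree n of [hd_conj_series], where the denominator is cleared; it determines the quotient
    degree by degree. *)
Lemma hd_conj_rec n a : hd_conj r k d n a =
  d n a + (if (k <= n)%N then hd_conj r k d (n - k)%N a * r - r * d (n - k)%N a else 0).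
Proof.
have := congr1 (@^~ n) (hd_conj_series a).
rewrite /= coef_one_minusM coef_Mone_minus /hd_series.
case: leqP => _; last by rewrite !subr0 addr0.
by move=> /eqP; rewrite subr_eq => /eqP ->; rewrite addrAC addrA.
Qed.

Lemma hd_conj_lt n : (n < k)%N -> hd_conj r k d n = d n.
Proof. by move=> nk; apply/funext => a; rewrite hd_conj_rec leqNgt nk addr0. Qed.

Lemma hd_conj_eq a : d 0 = id -> hd_conj r k d k a = d k a + (a * r - r * a).
Proof. by move=> d0; rewrite hd_conj_rec leqnn subnn hd_conj_lt // d0. Qed.

Lemma higher_derivation_conj : higher_derivation d ->
  higher_derivation (hd_conj r k d).
Proof.
move=> hd; have [d0 dB _] := hd; split; first by rewrite hd_conj_lt.
  move=> n a b; rewrite /hd_conj.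
  have -> : hd_series d (a - b) = hd_series d a - hd_series d b.
    by apply/funext => m; apply: dB.
  by rewrite mulrBr mulrBl.
move=> n _ a b; rewrite /hd_conj (higher_derivationM hd).
set u := one_minus_monomial r k; set v := geometric_series r k.
set f := hd_series d a; set g := hd_series d b.
rewrite -[RHS](coef_seriesM (u * f * v) (u * g * v)) !mulrA.
by rewrite -(mulrA (u * f) v u) /u /v geometricK // mulr1.
Qed.

Lemma hd_elem_conj : hd_mul (hd_elem r k) (hd_conj r k d) = d.
Proof.
apply/funext => n; apply/funext => a.
set f := hd_series (hd_conj r k d) a; set v := geometric_series r k.
transitivity ((v * f * one_minus_monomial r k) n); last first.
  by rewrite -mulrA hd_conj_series mulrA geometricK // mul1r.
rewrite coef_Mone_minus coef_seriesM /hd_mul.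
under eq_bigr do rewrite hd_elem_geometric //.
rewrite sumrB; congr (_ - _).
(* The subtracted terms add up to the coefficient of t^n in t^k v f r. *)
transitivity (shift k (v * f) n * r); last first.
  by rewrite /shift; case: ifP; rewrite ?mul0r.
rewrite -shiftM coef_seriesM big_distrl /=; apply: eq_bigr => i _.
by rewrite /shift; case: ifP; rewrite ?mul0r.
Qed.

End Conj.

(** * Infinite products of elementary inner higher derivations *)

Section Telescope.
Context (r : nat -> A) (d : nat -> nat -> A -> A).
Hypothesis d_conj : forall k, d k = hd_mul (hd_elem (r k.+1) k.+1) (d k.+1).

Let prod m n := \big[@hd_mul A/@hd_one A]_(m <= k < n) hd_elem (r k) k.

Lemma hd_telescope m n : d m = hd_mul (prod m.+1 (m + n).+1) (d (m + n)%N).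
Proof.
elim: n m => [|n IHn] m; first by rewrite addn0 /prod big_geq // hd_mul1.
rewrite /prod big_ltn ?ltnS ?addnS ?leq_addr // hd_mulA; last first.
  by move=> i; apply: hd_elemB.
by rewrite d_conj -addSn -IHn.
Qed.

(** The added factor, if any, is trivial in degrees below n. Products nest to the right, so the
    induction peels off the leftmost factors to reach it. *)
Lemma prod_hd_elem_stable m n i : (i < n)%N -> prod m n.+1 i = prod m n i.
Proof.
move=> lt_in; rewrite /prod; move: {2}(n - m)%N (erefl (n - m)%N) => p.
elim: p m i lt_in => [|p IHp] m i lt_in np.
  have le_nm : (n <= m)%N by rewrite -subn_eq0 np.
  rewrite [in RHS]big_geq //.
  case: (ltnP n m) => [lt_nm|le_mn]; first by rewrite big_geq.
  have -> : m = n by apply/eqP; rewrite eqn_leq le_mn.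
  rewrite big_ltn // big_geq // -[RHS](congr1 (@^~ i) (hd_mul1 (@hd_one A))).
  apply/funext => a; apply: eq_bigr => j _; rewrite hd_elem_lt //.
  exact: leq_ltn_trans (leq_ord j) lt_in.
have lt_mn : (m < n)%N by rewrite -subn_gt0 np.
rewrite (big_ltn (leqW lt_mn)) [in RHS]big_ltn //.
apply/funext => a; apply: eq_bigr => j _; rewrite (IHp m.+1) //.
  exact: leq_ltn_trans (leq_subr _ _) lt_in.
by rewrite subnS np.
Qed.

Lemma inner_hd_prod n i : (i <= n)%N -> inner_hd r i = prod 1 n.+1 i.
Proof.
move=> /subnK <-; elim: (n - i)%N => [|m IHm].
  rewrite /inner_hd; case: eqP => [->|//]; rewrite /prod big_geq //.
by rewrite IHm addSn [RHS]prod_hd_elem_stable // ltnS leq_addl.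
Qed.

(** In degree n only the factors up to n count, and the quotient [d n] already agrees with [e] up to
    that degree. *)
Lemma inner_hd_telescope (e : nat -> A -> A) :
  (forall n i, (i <= n)%N -> d n i = e i) -> d 0%N = hd_mul (inner_hd r) e.
Proof.
move=> de; apply/funext => n; apply/funext => a.
rewrite (hd_telescope 0 n) add0n; apply: eq_bigr => i _.
by rewrite -(inner_hd_prod (leq_ord i)) de // leq_subr.
Qed.

End Telescope.

End HigherDerivationProducts.

(** * Higher derivations of finitary incidence algebras *)

Section Incidence.
Context (disp : Order.disp_t) (P : porderType disp) (R : comPzRingType).
Implicit Types (a b : FI P R) (f g : P -> R) (x y z u v : P).

Lemma fi_eq0 a x y : ~~ (x <= y)%O -> a x y = 0.
Proof. exact: (fi_finitary a).1. Qed.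

Lemma fi_addE a b x y : (a + b) x y = a x y + b x y.
Proof. by []. Qed.

Lemma fi_oppE a x y : (- a) x y = - a x y.
Proof. by []. Qed.

Lemma fi_scaleE k a x y : (k *: a) x y = k * a x y.
Proof. by []. Qed.

Lemma fi_sumE (I : Type) (s : seq I) (F : I -> FI P R) x y :
  (\sum_(i <- s) F i) x y = \sum_(i <- s) F i x y.
Proof. by elim/big_rec2: _ => // i _ c _ <-. Qed.

Lemma fi_mul_single a b x y z : (x <= z <= y)%O ->
  (forall t, t != z -> a x t * b t y = 0) -> (a * b) x y = a x z * b z y.
Proof.
move=> xzy ab0; rewrite [LHS]/(convolution a b x y) /convolution.
rewrite -(@bigfs _ _ _ _ [:: z] (fun t => (x <= t <= y)%O)) //=.
  by rewrite big_mkcond big_seq1 xzy.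
by move=> t _; rewrite inE => /ab0.
Qed.

Definition diag f : FI P R := hadamard (fun x _ => f x) 1.

Lemma diagE f x y : diag f x y = f x * (x == y)%:R.
Proof. by []. Qed.

Lemma diagM f a x y : (diag f * a) x y = f x * a x y.
Proof.
have [xy|nxy] := boolP (x <= y)%O; last by rewrite !fi_eq0 ?mulr0.
rewrite (@fi_mul_single _ _ _ _ x) ?lexx // ?diagE ?eqxx ?mulr1 // => t.
by rewrite diagE eq_sym => /negPf->; rewrite mulr0 mul0r.
Qed.

Lemma Mdiag f a x y : (a * diag f) x y = a x y * f y.
Proof.
have [xy|nxy] := boolP (x <= y)%O; last by rewrite !fi_eq0 ?mul0r.
rewrite (@fi_mul_single _ _ _ _ y) ?lexx ?andbT // ?diagE ?eqxx ?mulr1 // => t.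
by rewrite diagE => /negPf->; rewrite !mulr0.
Qed.

Lemma diag_mul f g : diag f * diag g = diag (fun x => f x * g x).
Proof. by apply: fiP => x y _; rewrite diagM !diagE mulrA. Qed.

Definition idem x : FI P R := diag (fun z => (z == x)%:R).

Lemma finitary_munit x y :
  finitary (fun u v : P => [&& u == x, v == y & (x <= y)%O]%:R : R).
Proof.
split=> [u v|u v _].
  by case: (u =P x) => // ->; case: (v =P y) => // -> /negPf ->.
apply: sub_finite_set (finite_set1 (x, y)) => -[s t] /= [_ _ _].
by case: (s =P x) => [->|_]; case: (t =P y) => [->|_]; rewrite /= ?eqxx.
Qed.

(* The element e_xy if x <= y, and 0 otherwise. *)
Definition munit x y : FI P R := MkFI (finitary_munit x y).

Lemma munitE x y u v : munit x y u v = [&& u == x, v == y & (x <= y)%O]%:R.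
Proof. by []. Qed.

Lemma munitxx x : munit x x = idem x.
Proof.
apply: fiP => u v _; rewrite munitE diagE lexx andbT -natrM mulnb.
by congr (_ %:R); case: (u =P x) => //= ->; rewrite eq_sym.
Qed.

Lemma munitM x z y : (x <= z)%O -> (z <= y)%O -> munit x z * munit z y = munit x y.
Proof.
move=> xz zy; apply: fiP => u v uv; have xy := le_trans xz zy.
have [/andP[/eqP-> /eqP->]|nuv] := boolP ((u == x) && (v == y)).
  rewrite (@fi_mul_single _ _ _ _ z) ?xz //.
    by rewrite !munitE !eqxx xz zy xy mulr1.
  by move=> t /negPf tz; rewrite munitE tz andbF mul0r.
rewrite [RHS]munitE xy andbT (negPf nuv).
apply/eqP; apply: contraNT nuv => /convolution_neq0 [t [_ _]]; rewrite !munitE.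
by case: (u == x); case: (v == y); rewrite /= ?andbF ?eqxx.
Qed.

Lemma idem_mul_idem x y a : (x <= y)%O -> idem x * a * idem y = a x y *: munit x y.
Proof.
move=> xy; apply: fiP => u v uv; rewrite Mdiag diagM.
rewrite fi_scaleE munitE xy andbT.
by case: (u =P x) => [->|_]; case: (v =P y) => [->|_];
  rewrite ?mul1r ?mulr1 ?mul0r ?mulr0.
Qed.

(** * The Leibniz rule and constant idempotents *)

Section Leibniz.
Context (d : nat -> FI P R -> FI P R).
Hypotheses (hd : higher_derivation d) (d_lin : forall n, linear (d n)).

Lemma hd_scale n (k : R) a : d n (k *: a) = k *: d n a.
Proof.
have [_ dB _] := hd.
have d0 : d n 0 = 0 by have := dB n 0 0; rewrite !subrr.
by have := d_lin n k a 0; rewrite d0 !addr0.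
Qed.

Lemma hd0 n : d n 0 = 0.
Proof. by rewrite -[X in d n X](scale0r 0) hd_scale scale0r. Qed.

Lemma hdM n a b : d n (a * b) = \sum_(i < n.+1) d i a * d (n - i)%N b.
Proof. exact: (congr1 (fun c : series _ => c n) (higher_derivationM hd a b)). Qed.

Lemma hd_constantMl n a b : (forall i, (0 < i <= n)%N -> d i a = 0) ->
  d n (a * b) = a * d n b.
Proof.
have [d0 _ _] := hd => da0; rewrite hdM big_ord_recl d0 subn0 big1 ?addr0 // => i _.
by rewrite da0 ?mul0r // lift0 /=.
Qed.

Lemma hd_Mconstant n a b : (forall i, (0 < i <= n)%N -> d i b = 0) ->
  d n (a * b) = d n a * b.
Proof.
have [d0 _ _] := hd => db0; rewrite hdM big_ord_recr /= subnn d0 big1 ?add0r // => i _.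
by rewrite db0 ?mulr0 // subn_gt0 ltn_ord leq_subr.
Qed.

Lemma hd_entry n a x y : (forall i t, (0 < i <= n)%N -> d i (idem t) = 0) ->
  (x <= y)%O -> d n a x y = d n (munit x y) x y * a x y.
Proof.
move=> d0 xy.
have : d n (idem x * a * idem y) = idem x * d n a * idem y.
  by rewrite hd_Mconstant ?hd_constantMl //; move=> i; apply: d0.
move/(congr1 (fun c : FI P R => c x y)).
rewrite Mdiag diagM !eqxx mul1r mulr1 => <-.
by rewrite idem_mul_idem // hd_scale mulrC.
Qed.

(** Infinite sums of idempotents are handled entry by entry, through [hd_entry]. *)
Lemma hd_diag n f : (forall i t, (0 < i <= n)%N -> d i (idem t) = 0) ->
  (0 < n)%N -> d n (diag f) = 0.
Proof.
move=> d0 n0; apply: fiP => x y xy; rewrite hd_entry // diagE.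
have [<-|_] := eqVneq x y; last by rewrite !mulr0.
by rewrite munitxx d0 ?n0 ?leqnn // mul0r.
Qed.

(** * The inductive step: idempotents in degree n *)

Section Step.
Context (n : nat) (n_gt0 : (0 < n)%N).
Hypothesis d_idem : forall i t, (0 < i < n)%N -> d i (idem t) = 0.

(** The middle terms of the Leibniz sum vanish by [hd_diag] in degrees below n. *)
Lemma hd_diag_leibniz f g u v : d n (diag (fun x => f x * g x)) u v =
  d n (diag f) u v * g v + f u * d n (diag g) u v.
Proof.
have [d0 _ _] := hd.
have dd i h : (0 < i < n)%N -> d i (diag h) = 0.
  move=> /andP[i0 lt_in]; apply: hd_diag => // j t /andP[j0 ji].
  by apply: d_idem; rewrite j0 (leq_ltn_trans ji).
rewrite -diag_mul hdM; case: n n_gt0 dd => // m _ dd.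
rewrite big_ord_recl big_ord_recr /= subn0 subnn d0.
rewrite big1 => [|i _]; last first.
  by rewrite dd ?mul0r //= /bump add1n ltnS ltn_ord.
by rewrite add0r addrC -Mdiag -diagM.
Qed.

(* With e_S the sum of the e_x over S, the Leibniz rule for e_u e_S = 0 gives
   d_n(e_S)(u, v) = - d_n(e_u)(u, v) whenever v is in S and u is not. *)
Lemma hd_diag_cut f u v : f u = 0 -> f v = 1 ->
  d n (diag f) u v = - d n (idem u) u v.
Proof.
move=> fu fv; have := hd_diag_leibniz (fun z => (z == u)%:R) f u v.
have -> : (fun x => (x == u)%:R * f x) = (fun _ => 0).
  by apply/funext => x; case: eqP => [->|]; rewrite ?fu ?mulr0 ?mul0r.
have -> : diag (fun _ => 0) = 0 by apply: fiP => x y _; rewrite diagE mul0r.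
by rewrite hd0 eqxx fv mulr1 mul1r => /esym/eqP; rewrite addrC addr_eq0 => /eqP.
Qed.

Lemma hd_idemC u v : u != v -> d n (idem v) u v = - d n (idem u) u v.
Proof. by move=> /negPf uv; apply: hd_diag_cut; rewrite ?uv ?eqxx. Qed.

(** At this entry the Leibniz rule for e_x = e_x e_x reads c = c + c. *)
Lemma hd_idemxx x : d n (idem x) x x = 0.
Proof.
have := hd_diag_leibniz (fun z => (z == x)%:R) (fun z => (z == x)%:R) x x.
rewrite eqxx mulr1 mul1r.
have -> : (fun z => (z == x)%:R * (z == x)%:R) = (fun z => (z == x)%:R) :> (P -> R).
  by apply/funext => z; rewrite -natrM mulnb andbb.
by move=> /eqP; rewrite -[X in X == _]addr0 (inj_eq (addrI _)) eq_sym => /eqP.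
Qed.

Lemma finitary_hd_idem : finitary (fun u v => d n (idem v) u v).
Proof.
split=> [x y|x y xy]; first exact: fi_eq0.
apply: finite_set_of_cuts => [[u v] /= [_ uv _ _] eq_uv|S].
  by move: uv; rewrite eq_uv ltxx.
(* [diag f] is e_S, and d_n(e_S) is finitary. *)
pose f z : R := `[< S z >]%:R.
apply: sub_finite_set ((fi_finitary (d n (diag f))).2 _ _ xy) => -[u v] /=.
move=> [[xu uv vy duv] Sv Su]; split=> //.
have fu : f u = 0 by rewrite /f asboolF.
have fv : f v = 1 by rewrite /f asboolT.
by rewrite hd_diag_cut // -hd_idemC // lt_eqF.
Qed.

(** The correction e_x rho - rho e_x cancels column x by the choice of rho and row x by [hd_idemC];
    the other entries of d_n(e_x) are 0 by the Leibniz rule for e_x e_x. *)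
Lemma hd_conj_idem x : hd_conj (MkFI finitary_hd_idem) n d n (idem x) = 0.
Proof.
have [d0 _ _] := hd.
rewrite hd_conj_eq //; apply: fiP => u v _.
rewrite !fi_addE fi_oppE diagM Mdiag [fi_fun (MkFI _) u v]/=.
have [->|ux] := eqVneq u x; have [->|vx] := eqVneq v x.
- by rewrite mul1r mulr1 subrr addr0 hd_idemxx.
- by rewrite mul1r mulr0 subr0 hd_idemC ?subrr // eq_sym.
- by rewrite mul0r mulr1 sub0r subrr.
rewrite mul0r mulr0 subr0 addr0.
have xx : idem x = idem x * idem x.
  by rewrite diag_mul; congr diag; apply/funext => z; rewrite -natrM mulnb andbb.
have := hd_diag_leibniz (fun z => (z == x)%:R) (fun z => (z == x)%:R) u v.
by rewrite -diag_mul -xx (negPf ux) (negPf vx) mulr0 mul0r addr0.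
Qed.

End Step.

Lemma hd_conj_linear r k m : (0 < k)%N -> linear (hd_conj r k d m).
Proof.
move=> k0; elim/ltn_ind: m => m IHm c a b.
rewrite (hd_conj_rec r k0 d m (c *: a + b)) (hd_conj_rec r k0 d m a)
  (hd_conj_rec r k0 d m b) d_lin.
case: leqP => [le_km|_]; last by rewrite !addr0.
rewrite IHm ?d_lin ?ltn_subrL ?k0 ?(leq_trans k0) //.
rewrite mulrDl mulrDr -fi_scalerAl -fi_scalerAr.
by rewrite opprD (addrACA (c *: (_ * r))) -scalerBr addrACA -scalerDr.
Qed.

Lemma hd_transitive : (forall i t, (0 < i)%N -> d i (idem t) = 0) ->
  let sigma n x y := d n (munit x y) x y in
  higher_transitive sigma /\ d = transitive_hd sigma.
Proof.
move=> d_idem sigma; have [d0 _ _] := hd.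
have dE m a x y : (x <= y)%O -> d m a x y = sigma m x y * a x y.
  by apply: hd_entry => i t /andP[i0 _]; apply: d_idem.
split; last first.
  by apply/funext => m; apply/funext => a; apply: fiP => x y; apply: dE.
split=> [x y xy|m x z y xz zy]; first by rewrite /sigma d0 munitE !eqxx xy.
(* Each d_i(e_xz) is supported at (x, z), so only the middle index z contributes. *)
rewrite /sigma -(munitM xz zy) hdM fi_sumE; apply: eq_bigr => i _.
apply: fi_mul_single => [|t /negPf tz]; first by rewrite xz.
have [xt|nxt] := boolP (x <= t)%O; last by rewrite fi_eq0 ?mul0r.
by rewrite dE // munitE tz andbF mulr0 mul0r.
Qed.

End Leibniz.

End Incidence.

Theorem theorem2p8 (disp : Order.disp_t) (P : porderType disp)
    (R : comPzRingType) (d : nat -> FI P R -> FI P R)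
    (hd : higher_derivation d) (d_lin : forall n : nat, linear (d n)) :
  exists (rho : nat -> FI P R) (sigma : nat -> P -> P -> R),
    higher_transitive sigma /\
    d = hd_mul (inner_hd rho) (transitive_hd sigma).
Proof.
pose good n (c : nat -> FI P R -> FI P R) := [/\ higher_derivation c,
  forall m, linear (c m) & forall i x, (0 < i <= n)%N -> c i (idem R x) = 0].
have step (s : nat * (nat -> FI P R -> FI P R)) :
    exists r, good s.1 s.2 -> good s.1.+1 (hd_conj r s.1.+1 s.2).
  case: s => n c /=; have [[hc c_lin c_idem]|ngood] := pselect (good n c); last first.
    (* A default value: [choice] requires an element for every pair. *)
    by exists 0 => /ngood.
  exists (MkFI (finitary_hd_idem hc c_lin (ltn0Sn n) c_idem)) => _.
  split=> [|m|i x /andP[i0]]; first exact: higher_derivation_conj.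
    exact: hd_conj_linear.
  rewrite leq_eqVlt => /predU1P[->|lt_in]; first exact: hd_conj_idem.
  by rewrite hd_conj_lt // c_idem // i0.
have [r r_good] := choice step.
pose D := fix D n := if n is m.+1 then hd_conj (r (m, D m)) m.+1 (D m) else d.
have D_good n : good n (D n).
  elim: n => [|n IHn]; last exact: (r_good (n, D n)).
  by split=> // -[].
have D_stable n i : (i <= n)%N -> D n i = D i i.
  move=> /subnK <-; elim: (n - i)%N => [//|m IHm].
  by rewrite addSn /= hd_conj_lt // ltnS leq_addl.
(* The limit of the [D n], whose degree i is fixed from stage i on. *)
pose e i := D i i.
have he : higher_derivation e.
  split=> [|n|n n0 a b]; first by have [[]] := D_good 0%N.
    by have [[_ DB _] _ _] := D_good n; apply: DB.
  have [[_ _ DM] _ _] := D_good n; rewrite /e DM //; apply: eq_bigr => i _.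
  by rewrite !D_stable ?leq_subr ?leq_ord.
have e_lin n : linear (e n) by have [_ D_lin _] := D_good n; apply: D_lin.
have e_idem i x : (0 < i)%N -> e i (idem R x) = 0.
  by move=> i0; have [_ _ D_idem] := D_good i; apply: D_idem; rewrite i0 leqnn.
have [sigma_tr eE] := hd_transitive he e_lin e_idem.
(* rho_k for k > 0 is the element chosen at stage k - 1. *)
exists (fun k => r (k.-1, D k.-1)), (fun n x y => e n (munit R x y) x y).
split=> //; rewrite -eE.
apply: (@inner_hd_telescope _ _ D) => [k|]; last exact: D_stable.
by rewrite hd_elem_conj.
Qed.
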